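(* Let $G$ be a ribbon graph, and let $\rho\in\{\delta\tau,\tau\delta,\tau,\delta\tau\delta\}$. Then there exists a subset $A\subseteq E(G)$, together with an ordering $e_1,\ldots,e_k$ of the elements of $A$, such that $$\varepsilon(G^{\rho|A})=\varepsilon_M^{\rho}(G),\qquad\text{where } \varepsilon_M^{\rho}(G)=\max_{B\subseteq E(G)}\varepsilon(G^{\rho|B}),$$ and the sequence $$\varepsilon(G),\ \varepsilon(G^{\rho|\{e_1\}}),\ \varepsilon(G^{\rho|\{e_1,e_2\}}),\ \ldots,\ \varepsilon(G^{\rho|A})$$ is non-decreasing.
   Context: A (finite) ribbon graph $G$ with vertex set $V(G)$ and edge set $E(G)$ is a compact surface with boundary, possibly non-orientable, presented as the union of a set $V(G)$ of discs (vertices) and a set $E(G)$ of discs (edges), such that vertices and edges intersect in disjoint line segments, each such segment lies on the boundary of precisely one vertex and precisely one edge, and every edge contains exactly two such segments. If $G$ has $v$ vertices, $e$ edges, $f$ boundary components and $k$ connected components, its Euler genus is $\varepsilon(G)=2k-v+e-f$. Partial dual $G^{\delta|A}$, $A\subseteq E(G)$: take the boundary components of the spanning ribbon subgraph $(V(G),A)$ as curves on the surface of $G$, glue a disc to $G$ along each of these curves, and remove the interiors of all vertices of $G$; the glued discs are the vertices of $G^{\delta|A}$, and its edge set is identified with $E(G)$. Partial Petrial $G^{\tau|A}$: for each edge in $A$, detach one end of the edge from its incident vertex, give the edge a half-twist, and reattach it. Words are read left to right: $G^{\delta\tau|A}=(G^{\delta|A})^{\tau|A}$, $G^{\tau\delta|A}=(G^{\tau|A})^{\delta|A}$,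 $G^{\delta\tau\delta|A}=((G^{\delta|A})^{\tau|A})^{\delta|A}$. *)

(* Defs.v *)
From mathcomp Require Import all_boot all_order all_algebra.

Set Implicit Arguments.
Unset Strict Implicit.
Unset Printing Implicit Defensive.

Import Order.TTheory GRing.Theory Num.Theory.
Local Open Scope ring_scope.

(* Ribbon graphs are encoded by the gluing pattern of their discs.
   An edge disc e is a rectangle whose corners are the four flags (e, i, s):
   i says at which of the two ends of e the corner lies, s on which of the two
   sides. Thus (e, i, false) and (e, i, true) bound the segment in which end i
   of e meets a vertex, and (e, false, s) and (e, true, s) bound a free side
   of e. *)
Definition flag (E : finType) : finType := (E * bool * bool)%type.

Definition seg (E : finType) (x : flag E) : flag E :=
  let: (e, i, s) := x in (e, i, ~~ s).

Definition side (E : finType) (x : flag E) : flag E :=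
  let: (e, i, s) := x in (e, ~~ i, s).

(* Removing the segments from the boundary circles of the non-isolated vertices
   leaves arcs; arc x is the other end of the arc that starts at the corner x.
   Alternating seg and arc runs around a vertex, so every fixed-point-free
   involution arises in this way. Vertices that meet no edge carry no flag and
   are only counted. *)
Record ribbon_graph (E : finType) := RibbonGraph {
  arc : flag E -> flag E;
  arcK : involutive arc;
  arc_neq : forall x, arc x != x;
  isolated : nat
}.

Section EulerGenus.
Variables (E : finType) (G : ribbon_graph E).

Definition vertex_rel : rel (flag E) :=
  [rel x y | (y == seg x) || (y == arc G x)].

Definition boundary_rel : rel (flag E) :=
  [rel x y | (y == side x) || (y == arc G x)].

Definition component_rel : rel (flag E) :=
  [rel x y | [|| y == seg x, y == side x | y == arc G x]].

(* An isolated vertex is one vertex, one boundary component and one connected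
   component. *)
Definition num_vertices : nat := (n_comp vertex_rel predT + isolated G)%N.
Definition num_edges : nat := #|E|.
Definition num_boundaries : nat := (n_comp boundary_rel predT + isolated G)%N.
Definition num_components : nat := (n_comp component_rel predT + isolated G)%N.

Definition euler_genus : int :=
  2 * num_components%:Z - num_vertices%:Z + num_edges%:Z - num_boundaries%:Z.

Lemma segK : involutive (@seg E).
Proof. by move=> [[e i] s]; rewrite /= negbK. Qed.

Lemma sideK : involutive (@side E).
Proof. by move=> [[e i] s]; rewrite /= negbK. Qed.

Lemma inv_eq_swap (f : flag E -> flag E) :
  involutive f -> forall x y, (y == f x) = (x == f y).
Proof. by move=> fK x y; rewrite -(inj_eq (inv_inj fK)) fK eq_sym. Qed.

(* n_comp counts classes only for relations with a symmetric closure. *)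
Lemma vertex_connect_sym : connect_sym vertex_rel.
Proof.
by apply: sym_connect_sym => x y; rewrite /vertex_rel /=;
  rewrite (inv_eq_swap segK) (inv_eq_swap (@arcK E G)).
Qed.

Lemma boundary_connect_sym : connect_sym boundary_rel.
Proof.
by apply: sym_connect_sym => x y; rewrite /boundary_rel /=;
  rewrite (inv_eq_swap sideK) (inv_eq_swap (@arcK E G)).
Qed.

Lemma component_connect_sym : connect_sym component_rel.
Proof.
by apply: sym_connect_sym => x y; rewrite /component_rel /=;
  rewrite (inv_eq_swap segK) (inv_eq_swap sideK) (inv_eq_swap (@arcK E G)).
Qed.

End EulerGenus.

Section Relabel.
Variables (E : finType) (phi : flag E -> flag E) (phiK : involutive phi).
Variable G : ribbon_graph E.

Lemma relabel_arcK : involutive (phi \o arc G \o phi).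
Proof. by move=> x; rewrite /= phiK arcK phiK. Qed.

Lemma relabel_arc_neq x : (phi \o arc G \o phi) x != x.
Proof. by rewrite /= -(inj_eq (inv_inj phiK)) phiK arc_neq. Qed.

Definition relabel : ribbon_graph E :=
  RibbonGraph relabel_arcK relabel_arc_neq (isolated G).

End Relabel.

Section PartialTwuals.
Variables (E : finType) (A : {set E}).

Definition dual_flag (x : flag E) : flag E :=
  let: (e, i, s) := x in if e \in A then (e, s, i) else (e, i, s).

Lemma dual_flagK : involutive dual_flag.
Proof. by move=> [[e i] s] /=; case: ifP => /= ->. Qed.

(* The boundary components of (V(G), A) run along the vertex arcs, along the
   free sides of the edges in A and along the segments of the other edges.
   Once discs are glued along them and the old vertices are removed, the arcs
   are unchanged, while each edge in A is attached along its former sides and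
   its former segments are free. *)
Definition partial_dual (G : ribbon_graph E) : ribbon_graph E :=
  relabel dual_flagK G.

Definition twist_flag (x : flag E) : flag E :=
  let: (e, i, s) := x in if (e \in A) && i then (e, i, ~~ s) else (e, i, s).

Lemma twist_flagK : involutive twist_flag.
Proof. by move=> [[e i] s] /=; case: ifP => /= ->; rewrite ?negbK. Qed.

(* The end true of each edge in A is reattached after a half-twist, that is,
   with its two corners exchanged. Twisting the end false instead gives the
   same ribbon graph up to exchanging the names of the two sides. *)
Definition partial_petrial (G : ribbon_graph E) : ribbon_graph E :=
  relabel twist_flagK G.

End PartialTwuals.

Inductive twist_op := delta | tau.

Definition apply_op (E : finType) (A : {set E}) (G : ribbon_graph E)
    (o : twist_op) : ribbon_graph E :=
  match o with
  | delta => partial_dual A G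
  | tau => partial_petrial A G
  end.

Definition partial_twual (E : finType) (rho : seq twist_op)
    (G : ribbon_graph E) (A : {set E}) : ribbon_graph E :=
  foldl (apply_op A) G rho.

(* The initial value of the iterated maximum is one of its terms, so this is
   the maximum over all B. *)
Definition max_euler_genus (E : finType) (rho : seq twist_op)
    (G : ribbon_graph E) : int :=
  \big[Num.max/euler_genus (partial_twual rho G set0)]_(B : {set E})
    euler_genus (partial_twual rho G B).

(* Main.v *)
Require Import Defs.
From mathcomp Require Import all_boot all_order all_algebra.
From mathcomp Require Import fingraph ring.

(* Each edge has four corners, and these have three perfect matchings: segments,
   sides and diagonals. A partial twual G^{rho|A} leaves the arcs alone and
   replaces, on the edges of A, one matching by another. So its vertices and its
   boundary components are counted by two functions c1(A), c2(A), each the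
   number of circuits made of arcs and of a matching that is switched on A, and
   eps(G^{rho|A}) is a constant minus c1(A) + c2(A).

   Switching one edge raises such a count c by at most 1. If A is a subset of B
   and c(B) < c(A), then some corner x and its partner for B lie on different
   circuits for A; the edge of x is then in B but not in A, and switching it
   merges these circuits, so c drops by 1. Hence, starting from the empty set and
   going up to a maximizer B, as long as c1(A) + c2(A) exceeds its value at B one
   can switch an edge of B that lowers c1 or c2, while the other grows by at
   most 1. *)

Set Implicit Arguments.
Unset Strict Implicit.
Unset Printing Implicit Defensive.

(** * Comparing the numbers of components of two relations *)

Section ComponentCount.
Variables (T : finType) (e e' : rel T).
Hypotheses (sym_e : connect_sym e) (sym_e' : connect_sym e').

Lemma n_comp_sub : subrel e (connect e') -> n_comp e' predT <= n_comp e predT.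
Proof.
move=> /connect_sub sub; rewrite /n_comp_mem.
rewrite -[X in X <= _](@card_in_imset _ _ (root e)).
  apply/subset_leq_card/subsetP => _ /imsetP[x _ ->].
  by rewrite !inE andbT roots_root.
move=> x y; rewrite !inE !andbT => /eqP rx /eqP ry /(rootP sym_e) /sub.
by move/(rootP sym_e'); rewrite rx ry.
Qed.

(** An injection from the roots of [e'] to those of [e] can avoid the root of [y], because the
    [e]-classes of [x] and [y] lie in one [e']-class. *)
Lemma n_comp_sub_lt x y :
    subrel e (connect e') -> connect e' x y -> ~~ connect e x y ->
  n_comp e' predT < n_comp e predT.
Proof.
move=> /connect_sub sub e'xy nexy; rewrite /n_comp_mem.
rewrite [X in _ < X](cardD1 (root e y)) !inE roots_root //= add1n ltnS.
pose D := [predD1 [predI roots e & predT] & root e y].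
have [g gP] : exists g : T -> T, forall r, r \in roots e' ->
    (g r \in D) && (connect e' (g r) r).
  (* Each root goes to its [e]-root, except that the class of [y] is redirected to that of [x]. *)
  exists (fun r => if root e r == root e y then root e x else root e r) => r _.
  case: ifP => [ry|nry]; rewrite !inE ?nry roots_root //= ?andbT.
    rewrite root_connect // nexy /=.
    apply: (connect_trans (y := x)); first by rewrite sym_e' sub // connect_root.
    apply: (connect_trans e'xy); apply: sub.
    by rewrite -root_connect // eq_sym.
  by rewrite sym_e' sub // connect_root.
rewrite -[X in X <= _](@card_in_imset _ _ g).
  apply/subset_leq_card/subsetP => _ /imsetP[r rr ->].
  by move: rr; rewrite inE andbT => /gP /andP[].
move=> u v; rewrite !inE !andbT => ru rv guv.
have [] := (andP (gP u ru), andP (gP v rv)) => -[_ gu] [_ gv].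
move/eqP: ru => <-; move/eqP: rv => <-; apply/(rootP sym_e').
by rewrite (connect_trans _ gv) // -guv sym_e'.
Qed.

(** The equivalence relation generated by [e] and the single pair [(x, y)]. *)
Definition link x y : rel T := [rel u v | connect e u v ||
  (connect e u x || connect e u y) && (connect e v x || connect e v y)].

Lemma link_trans x y : transitive (link x y).
Proof.
rewrite /link => v u w /=.
have eqc a b c : connect e a b -> connect e b c = connect e a c.
  by move=> ab; rewrite (same_connect sym_e ab).
case: (boolP (connect e u v)) => [uv _|_ /= /andP[-> vxy]]; first by rewrite !(eqc _ _ _ uv).
case/orP => [vw|/andP[_ ->]]; last by rewrite orbT.
by rewrite !(eqc _ _ _ vw) vxy orbT.
Qed.

(** One extra pair merges at most two classes: with the root of [y] set aside, distinct [e]-roots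
    stay in distinct [e']-classes. *)
Lemma n_comp_link x y :
  subrel e' (link x y) -> n_comp e predT <= (n_comp e' predT).+1.
Proof.
move=> sub1.
have sub u v : connect e' u v -> link x y u v.
  case/connectP=> p; elim: p u => [|w p IH] u /=; first by move=> _ ->; rewrite /link /= connect0.
  by case/andP=> /sub1 uw pw lv; apply: link_trans uw (IH _ pw lv).
rewrite /n_comp_mem [X in X <= _](cardD1 (root e y)) -add1n leq_add ?leq_b1 //.
rewrite -[X in X <= _](@card_in_imset _ _ (root e')).
  apply/subset_leq_card/subsetP => _ /imsetP[u _ ->].
  by rewrite !inE andbT roots_root.
move=> u v; rewrite !inE !andbT => /andP[nu /eqP ru] /andP[nv /eqP rv].
rewrite -ru root_connect // in nu; rewrite -rv root_connect // in nv.
move=> /(rootP sym_e') /sub; rewrite /link /= (negbTE nu) (negbTE nv) !orbF.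
case/orP => [uv|/andP[ux vx]]; rewrite -ru -rv; apply/(rootP sym_e) => //.
by apply: connect_trans ux _; rewrite sym_e.
Qed.

End ComponentCount.

(** * Switching a matching on four points *)

Lemma odd_card_fpf_invol (T : finType) (f : T -> T) (K : {set T}) :
    involutive f -> (forall x, f x != x) -> (forall x, x \in K -> f x \in K) ->
  ~~ odd #|K|.
Proof.
move=> fK fN; have [n] := ubnP #|K|; elim: n K => // n IH K leK Kf.
have [->|[x xK]] := set_0Vmem K; first by rewrite cards0.
have fxK : f x \in K :\ x by rewrite !inE fN Kf.
rewrite (cardsD1 x) xK (cardsD1 (f x)) fxK /= negbK.
apply: IH => [|y].
  by move: leK; rewrite (cardsD1 x) xK (cardsD1 (f x)) fxK /= => /ltnW.
rewrite !inE => /and3P[yfx yx yK].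
by rewrite (inj_eq (inv_inj fK)) yx Kf // andbT -(inj_eq (inv_inj fK)) fK yfx.
Qed.

Section Matchings.
Variables (T : finType).

Definition matching_rel (t a : T -> T) : rel T :=
  [rel x y | (y == t x) || (y == a x)].

Lemma matching_sym t a :
  involutive t -> involutive a -> connect_sym (matching_rel t a).
Proof.
move=> tK aK; apply: sym_connect_sym => x y /=.
by rewrite /matching_rel /= (eq_sym y) (inv_eq tK) (eq_sym y) (inv_eq aK) !(eq_sym x).
Qed.

Lemma connect_left t a x : connect (matching_rel t a) x (t x).
Proof. by apply: connect1; rewrite /matching_rel /= eqxx. Qed.

Lemma connect_right t a x : connect (matching_rel t a) x (a x).
Proof. by apply: connect1; rewrite /matching_rel /= eqxx orbT. Qed.

Variables (a t t' : T -> T) (x : T).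
Hypotheses (aK : involutive a) (aN : forall z, a z != z).
Hypotheses (tK : involutive t) (tN : forall z, t z != z).
Hypothesis t'K : involutive t'.

Let Q := [:: x; t x; t' x; t (t' x)].
Hypothesis t_out : forall z, z \notin Q -> t' z = t z.

(** Leaving [Q] unmatched gives a common refinement [r0] of the circuits of [t] and of [t']. *)
Let t0 z := if z \in Q then z else t z.
Let r0 := matching_rel t0 a.

Let QtE z : (t z \in Q) = (z \in Q).
Proof.
rewrite !inE !(inv_eq tK) !tK.
by case: (z == x); case: (z == t x); case: (z == t' x); case: (z == t (t' x)).
Qed.

Let t0K : involutive t0.
Proof. by move=> z; rewrite /t0; case: (boolP (z \in Q)) => zQ; rewrite ?zQ // QtE (negbTE zQ) tK. Qed.

Let sym0 : connect_sym r0. Proof. exact: matching_sym. Qed.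
Let symt : connect_sym (matching_rel t a). Proof. exact: matching_sym. Qed.
Let symt' : connect_sym (matching_rel t' a). Proof. exact: matching_sym. Qed.

(* With the four points of Q left unmatched by t, the component of a point
   of Q is a path, and its other end lies in Q as well. *)
Let path_end u : u \in Q -> exists v, [/\ v \in Q, v != u & connect r0 u v].
Proof.
move=> uQ; have [/existsP[v /and3P[]]|/existsPn noend] :=
  boolP [exists v, [&& v \in Q, v != u & connect r0 u v]]; first by exists v.
(* If [u] were the only point of [Q] in its component [K], then [a] would pair off [K] and [t] would
   pair off [K] without [u], against parity. *)
pose K := [set z | connect r0 u z].
have evK : ~~ odd #|K|.
  apply: (odd_card_fpf_invol aK aN) => z; rewrite !inE => uz.
  by apply: connect_trans uz (connect_right _ _ _).
have evKu : ~~ odd #|K :\ u|.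
  apply: (odd_card_fpf_invol tK tN) => z; rewrite !in_setD1 !inE => /andP[zu uz].
  have zQ : z \notin Q by move: (noend z); rewrite zu uz !andbT.
  apply/andP; split; first by apply: contraNneq zQ => tzu; rewrite -QtE tzu.
  apply: connect_trans uz (connect1 _).
  by rewrite /r0 /matching_rel /= /t0 (negbTE zQ) eqxx.
by move: evK; rewrite (cardsD1 u) inE connect0 /= evKu.
Qed.

Let sub0t : subrel r0 (connect (matching_rel t a)).
Proof.
move=> u v; rewrite /r0 /matching_rel /= /t0.
by case: ifP => _ /orP[]/eqP->;
  rewrite ?connect0 ?(connect_left t a) ?(connect_right t a).
Qed.

Let sub0t' : subrel r0 (connect (matching_rel t' a)).
Proof.
move=> u v; rewrite /r0 /matching_rel /= /t0.
by case: ifP => [_|/negbT uQ] /orP[]/eqP->;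
  rewrite ?connect0 -?(t_out uQ) ?(connect_left t' a) ?(connect_right t' a).
Qed.

(** Since [x] and [t' x] lie on different circuits of [t], the path of [r0] from [x] can only end at
    [t x], and the one from [t' x] at [t (t' x)]. So cutting [t] on [Q] separates nothing within
    either circuit, and the new pair [x], [t' x] merges the two. *)
Lemma n_comp_switch_merge : ~~ connect (matching_rel t a) x (t' x) ->
  n_comp (matching_rel t' a) predT < n_comp (matching_rel t a) predT.
Proof.
set C := connect (matching_rel t a) => nxy.
have Ct u : C u (t u) by exact: connect_left.
have Cx : C x (t x) := Ct x; have Cy : C (t' x) (t (t' x)) := Ct _.
have nC u v : C x u -> C (t' x) v -> ~~ C u v.
  move=> xu yv; apply: contra nxy => uv; apply: connect_trans xu _.
  by apply: connect_trans uv _; rewrite symt.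
have C0 u : C u u by exact: connect0.
have sub u v : connect r0 u v -> C u v by exact: connect_sub.
have xE : connect r0 x (t x).
  have [v [vQ vx xv]] := path_end (mem_head x _).
  move: vQ; rewrite inE (negbTE vx) !inE /=.
  case/or3P => /eqP vE; move: xv; rewrite vE // => /sub;
  by rewrite (negbTE (nC _ _ _ _)) ?C0.
have yE : connect r0 (t' x) (t (t' x)).
  have yQ : t' x \in Q by rewrite !inE eqxx !orbT.
  have [v [vQ vy yv]] := path_end yQ.
  move: vQ; rewrite !inE (negbTE vy) /= orbA.
  case/orP => [|/eqP<- //] /orP[]/eqP vE; move: yv; rewrite vE sym0 => /sub;
  by rewrite (negbTE (nC _ _ _ _)) ?C0.
apply: (n_comp_sub_lt symt symt' (x := x) (y := t' x)) nxy => //; last first.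
  exact: connect_left.
move=> u v /orP[]/eqP->; last by exact: connect_right.
have [uQ|uQ] := boolP (u \in Q); last by rewrite -(t_out uQ) connect_left.
apply: (connect_sub sub0t').
by move: uQ; rewrite !inE => /or4P[] /eqP ->; rewrite ?tK // sym0.
Qed.

(** The graph of [t'] has at most as many components as [r0], so it suffices that the two pairs of
    [t] in [Q] together act on [r0] as a single link. *)
Lemma n_comp_switch_le :
  n_comp (matching_rel t' a) predT <= (n_comp (matching_rel t a) predT).+1.
Proof.
apply: leq_trans (n_comp_sub sym0 symt' sub0t') _.
have [z _ zlink] : exists2 z, z \in Q & forall u, u \in Q -> link r0 z (t z) u (t u).
  have [v [vQ vx xv]] := path_end (mem_head x _).
  (* If [r0] already joins [x] to [t x], only the other pair links anything. Otherwise [r0] joins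
     [x] to a point [w] of the other pair and [t w] to [x] or [t x], so the pair [w], [t w] links
     nothing beyond what [x], [t x] links. *)
  have [xtx|nxtx] := boolP (connect r0 x (t x)).
    exists (t' x); first by rewrite !inE eqxx !orbT.
    move=> u; rewrite !inE => /or4P[] /eqP ->; rewrite /link /= ?tK ?connect0 ?orbT ?xtx //.
    by rewrite sym0 xtx.
  have [w [wE wx xw]] : exists w, [/\ w = t' x \/ w = t (t' x), w \in Q & connect r0 x w].
    exists v; split=> //; move: vQ; rewrite inE (negbTE vx) !inE /=.
    by case/or3P => /eqP vE; [rewrite -vE xv in nxtx | left | right].
  have twQ : t w \in Q by rewrite QtE.
  have QE u : u \in Q -> [|| u == x, u == t x, u == w | u == t w].
    by rewrite !inE; case: wE => ->; rewrite ?tK // => /or4P[]->; rewrite ?orbT.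
  have L : connect r0 (t w) x || connect r0 (t w) (t x).
    have [p [/QE pQ pw wp]] := path_end twQ; move: pQ wp; rewrite (negbTE pw) orbF.
    by case/or3P => /eqP -> wp; rewrite ?wp ?orbT // (connect_trans wp) // sym0.
  exists x; first exact: mem_head.
  move=> u /QE /or4P[] /eqP ->; rewrite /link /= ?tK ?connect0 ?orbT ?L //=;
  by rewrite (sym0 w x) xw ?orbT.
suff: subrel (matching_rel t a) (link r0 z (t z)) by move/(n_comp_link sym0 symt).
move=> u v /orP[]/eqP->.
  have [/zlink //|uQ] := boolP (u \in Q).
  by rewrite /link /= connect1 //= /r0 /matching_rel /= /t0 (negbTE uQ) eqxx.
by rewrite /link /= connect1 //= /r0 /matching_rel /= eqxx orbT.
Qed.

End Matchings.

Lemma n_comp_conj (T : finType) (h : T -> T) (e e' : rel T) :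
    connect_sym e -> connect_sym e' -> involutive h ->
    (forall x y, e' x y = e (h x) (h y)) ->
  n_comp e' predT = n_comp e predT.
Proof.
move=> sym_e sym_e' hK e'E.
have cl : closed e predT by [].
have adj : rel_adjunction h e e' predT.
  apply: strict_adjunction => //; first exact: inv_inj.
  by apply/subsetP=> x _; rewrite -(hK x) codom_f.
by rewrite (adjunction_n_comp h sym_e sym_e' cl adj).
Qed.

(** * Matchings of the corners of the edges, and their circuits *)

Section Flips.
Variable E : finType.

(** Translations of the Klein four-group: [(false, true)] is the segment matching, [(true, false)]
    the side matching and [(true, true)] the diagonal one. *)
Definition flip (p : bool * bool) (x : flag E) : flag E :=
  let: (e, i, s) := x in (e, i (+) p.1, s (+) p.2).

Lemma flip_edge p x : (flip p x).1.1 = x.1.1.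
Proof. by case: x => [[]]. Qed.

Lemma flipK p : involutive (flip p).
Proof. by move=> [[e i] s]; rewrite /= -!addbA !addbb !addbF. Qed.

Lemma flip_neq p x : p != (false, false) -> flip p x != x.
Proof. by case: p x => [[] []] [[e [] ] []] // _; rewrite /= !xpair_eqE !andbF. Qed.

(** Two distinct nonzero translations generate the group, so the list holds all four corners of the
    edge. *)
Lemma flip_cover p q x z :
    p != (false, false) -> q != (false, false) -> p != q -> z.1.1 = x.1.1 ->
  z \in [:: x; flip p x; flip q x; flip p (flip q x)].
Proof.
case: x z => [[e i] s] [[e' i'] s'] /= + + + ->.
by case: p q i s i' s' => [[] []] [[] []] [] [] [] [] // _ _ _;
  rewrite !inE /= !xpair_eqE /= !eqxx.
Qed.

Definition mixed_flip (p q : bool * bool) (A : {set E}) (x : flag E) : flag E :=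
  flip (if x.1.1 \in A then q else p) x.

Lemma mixed_flipK p q A : involutive (mixed_flip p q A).
Proof. by move=> x; rewrite /mixed_flip flip_edge flipK. Qed.

Variables (a : flag E -> flag E) (p q : bool * bool).
Hypotheses (aK : involutive a) (aN : forall x, a x != x).
Hypotheses (p0 : p != (false, false)) (q0 : q != (false, false)).

Definition num_circuits (A : {set E}) : nat :=
  n_comp (matching_rel (mixed_flip p q A) a) predT.

Lemma mixed_flip_neq A x : mixed_flip p q A x != x.
Proof. by rewrite /mixed_flip; case: ifP => _; apply: flip_neq. Qed.

Lemma mixed_flip_switch_out e (A : {set E}) x z : x.1.1 = e -> e \notin A ->
  z \notin [:: x; mixed_flip p q A x; mixed_flip p q (e |: A) x;
               mixed_flip p q A (mixed_flip p q (e |: A) x)] ->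
  mixed_flip p q (e |: A) z = mixed_flip p q A z.
Proof.
move=> xe eA.
rewrite /mixed_flip !flip_edge xe setU11 (negbTE eA) !inE => zQ.
have [ze|//] := eqVneq z.1.1 e; rewrite ze (negbTE eA) /=.
have [-> //|pq] := eqVneq p q.
by move: (flip_cover p0 q0 pq (etrans ze (esym xe))); rewrite !inE (negbTE zQ).
Qed.

Lemma num_circuits_setU1 e (A : {set E}) :
  e \notin A -> num_circuits (e |: A) <= (num_circuits A).+1.
Proof.
move=> eA; apply: (@n_comp_switch_le _ _ _ _ (e, false, false)) => //.
- exact: mixed_flipK.
- exact: mixed_flip_neq.
- exact: mixed_flipK.
- by move=> z; apply: mixed_flip_switch_out.
Qed.

Lemma num_circuits_exchange (A B : {set E}) :
    A \subset B -> num_circuits B < num_circuits A ->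
  exists e, [/\ e \in B, e \notin A & num_circuits (e |: A) < num_circuits A].
Proof.
move=> AB ltBA.
have symA := matching_sym (mixed_flipK p q A) aK.
have symB := matching_sym (mixed_flipK p q B) aK.
(* If every partner for [B] stays on the same circuit for [A], the circuits for [B] refine those for
   [A], contradicting the strict inequality. *)
have [/forallP refine|/forallPn[x nx]] :=
  boolP [forall x, connect (matching_rel (mixed_flip p q A) a) x (mixed_flip p q B x)].
  have sub : subrel (matching_rel (mixed_flip p q B) a)
                    (connect (matching_rel (mixed_flip p q A) a)).
    by move=> x y /orP[]/eqP-> //; exact: connect_right.
  have leAB : num_circuits A <= num_circuits B := n_comp_sub symB symA sub.
  by rewrite ltnNge leAB in ltBA.
have nx' : mixed_flip p q B x != mixed_flip p q A x.
  by apply: contraNneq nx => ->; apply: connect_left.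
have [xB xA] : x.1.1 \in B /\ x.1.1 \notin A.
  move: nx'; rewrite /mixed_flip; have [xA|_] := boolP (x.1.1 \in A).
    by rewrite (subsetP AB _ xA) eqxx.
  by case: (x.1.1 \in B) => //; rewrite eqxx.
exists x.1.1; split; [exact: xB | exact: xA | ].
apply: (@n_comp_switch_merge _ _ _ _ x) => //.
- exact: mixed_flipK.
- exact: mixed_flip_neq.
- exact: mixed_flipK.
- by move=> z; apply: mixed_flip_switch_out.
(* As the edge of [x] is in [B], switching it gives [x] its partner for [B]. *)
- by move: nx; rewrite {2 4}/mixed_flip setU11 xB.
Qed.

End Flips.

(** * Greedy construction of the ordering *)

Section Greedy.
Variables (E : finType) (c1 c2 : {set E} -> nat).

Let exchange (c : {set E} -> nat) := forall A B : {set E},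
  A \subset B -> c B < c A -> exists e, [/\ e \in B, e \notin A & c (e |: A) < c A].
Let step_le (c : {set E} -> nat) := forall e (A : {set E}),
  e \notin A -> c (e |: A) <= (c A).+1.

Hypotheses (exchange1 : exchange c1) (exchange2 : exchange c2).
Hypotheses (step1 : step_le c1) (step2 : step_le c2).

Lemma exchange_sum (A B : {set E}) :
    A \subset B -> c1 B + c2 B < c1 A + c2 A ->
  exists e, [/\ e \in B, e \notin A & c1 (e |: A) + c2 (e |: A) <= c1 A + c2 A].
Proof.
move=> AB ltBA.
have [le1|lt1] := leqP (c1 A) (c1 B); last first.
  have [e [eB eA lt]] := exchange1 AB lt1; exists e; split=> //.
  by have := leq_add lt (step2 eA); rewrite addnS addSn ltnS.
have lt2 : c2 B < c2 A.
  by rewrite ltnNge; apply: contraL ltBA => le2; rewrite -leqNgt leq_add.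
have [e [eB eA lt]] := exchange2 AB lt2; exists e; split=> //.
by have := leq_add (step1 eA) lt; rewrite addnS addSn ltnS.
Qed.

(** Induction on the size of [B :\: A]; the chain stops once the sum is no larger than at [B],
    possibly before reaching [B]. *)
Lemma greedy_chain (A B : {set E}) : A \subset B ->
  exists s : seq E,
    [/\ uniq s, {in s, forall e, e \notin A},
        c1 (A :|: [set e in s]) + c2 (A :|: [set e in s]) <= c1 B + c2 B
      & forall k, k < size s ->
          c1 (A :|: [set e in take k.+1 s]) + c2 (A :|: [set e in take k.+1 s]) <=
          c1 (A :|: [set e in take k s]) + c2 (A :|: [set e in take k s])].
Proof.
have [n] := ubnP #|B :\: A|; elim: n A => // n IH A ltn AB.
have set_nilU : A :|: [set e in [::]] = A by apply/setP=> z; rewrite !inE orbF.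
have [leAB|ltBA] := leqP (c1 A + c2 A) (c1 B + c2 B).
  by exists [::]; split=> //; rewrite set_nilU.
have [e [eB eA le_e]] := exchange_sum AB ltBA.
have consU (s : seq E) : A :|: [set z in e :: s] = (e |: A) :|: [set z in s].
  by apply/setP=> z; rewrite !inE orbCA orbA.
have [||s [us sA les sorted_s]] := IH (e |: A).
- move: ltn; rewrite (cardsD1 e) !inE eB eA ltnS; apply: leq_trans.
  by apply/subset_leq_card/subsetP=> z; rewrite !inE negb_or andbA.
- by rewrite subUset sub1set eB.
exists (e :: s); split.
- by rewrite /= us andbT; apply/negP=> /sA; rewrite !inE eqxx.
- by move=> z; rewrite inE => /predU1P[-> //|/sA]; rewrite !inE negb_or => /andP[].
- by rewrite consU.
move=> [|k] /= ltk; last by rewrite !consU; apply: sorted_s.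
rewrite consU take0 set_nilU.
by have -> : (e |: A) :|: [set z in [::]] = e |: A by apply/setP=> z; rewrite !inE orbF.
Qed.

End Greedy.

(** * Invariance under relabelling of corners *)

Section Relabelling.
Variables (E : finType) (phi : flag E -> flag E) (phiK : involutive phi).
Variable G : ribbon_graph E.

Lemma n_comp_matching_relabel t : involutive t ->
  n_comp (matching_rel t (Defs.arc (relabel phiK G))) predT =
  n_comp (matching_rel (phi \o t \o phi) (Defs.arc G)) predT.
Proof.
move=> tK; apply: (n_comp_conj (h := phi)) => //.
- by apply: matching_sym (@arcK _ G) => x; rewrite /= phiK tK phiK.
- by apply: matching_sym => //; apply: relabel_arcK (phiK) _.
by move=> x y; rewrite /matching_rel /= phiK (inj_eq (inv_inj phiK)) (inv_eq phiK).
Qed.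

(** Segments and sides together connect all four corners of an edge, so connectivity depends only on
    the arcs and on which edge a corner belongs to. *)
Lemma num_components_relabel :
  (forall x, (phi x).1.1 = x.1.1) -> num_components (relabel phiK G) = num_components G.
Proof.
move=> phi_edge.
pose edge_rel (H : ribbon_graph E) : rel (flag E) :=
  [rel x y | (x.1.1 == y.1.1) || (y == Defs.arc H x)].
have edge_sym H : connect_sym (edge_rel H).
  apply: sym_connect_sym => x y; rewrite /edge_rel /= eq_sym.
  by rewrite (eq_sym y) (inv_eq (@arcK _ H)) (eq_sym x).
have edgeE H : n_comp (component_rel H) predT = n_comp (edge_rel H) predT.
  apply/eqP; rewrite eqn_leq; apply/andP; split.
    apply: (n_comp_sub (edge_sym H) (@component_connect_sym E H)) => x y.
    case/orP=> [/eqP xy|/eqP->]; last by apply: connect1; rewrite /component_rel /= eqxx !orbT.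
    have seg1 z : connect (component_rel H) z (seg z).
      by apply: connect1; rewrite /component_rel /= eqxx.
    have side1 z : connect (component_rel H) z (side z).
      by apply: connect1; rewrite /component_rel /= eqxx orbT.
    have := flip_cover (p := (true, false)) (q := (false, true))
      isT isT isT (esym xy).
    have sideE z : flip (true, false) z = side z by case: z => [[e i] s]; rewrite /= addbT addbF.
    have segE z : flip (false, true) z = seg z by case: z => [[e i] s]; rewrite /= addbT addbF.
    rewrite sideE segE sideE !inE => /or4P[] /eqP -> //.
    exact: connect_trans (seg1 _) (side1 _).
  apply: (n_comp_sub (@component_connect_sym E H) (edge_sym H)) => x y.
  by case/or3P=> /eqP->; apply: connect1; rewrite /edge_rel /= ?eqxx ?orbT //;
    case: x => [[e i] s]; rewrite /= eqxx.
have relabelE : n_comp (edge_rel (relabel phiK G)) predT = n_comp (edge_rel G) predT.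
  apply: (n_comp_conj (edge_sym _) (edge_sym _) phiK) => x y.
  by rewrite /edge_rel /= !phi_edge (inv_eq phiK).
by rewrite /num_components !edgeE relabelE.
Qed.

End Relabelling.

Import Order.TTheory GRing.Theory Num.Theory.
Local Open Scope ring_scope.


(** * The Euler genus of a partial twual in terms of circuits *)

Lemma eq_n_comp_matching (T : finType) (a t t' : T -> T) : t =1 t' ->
  n_comp (matching_rel t a) predT = n_comp (matching_rel t' a) predT.
Proof.
by move=> tt'; apply: eq_n_comp; apply: eq_connect => x y; rewrite /matching_rel /= tt'.
Qed.

Lemma dual_flag_edge (E : finType) (A : {set E}) x : (dual_flag A x).1.1 = x.1.1.
Proof. by case: x => [[e i] s] /=; case: ifP. Qed.

Lemma twist_flag_edge (E : finType) (A : {set E}) x : (twist_flag A x).1.1 = x.1.1.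
Proof. by case: x => [[e i] s] /=; case: ifP. Qed.

Lemma num_components_twual (E : finType) (rho : seq twist_op) (G : ribbon_graph E) A :
  num_components (partial_twual rho G A) = num_components G.
Proof.
elim: rho G => //= o rho IH G; rewrite IH.
by case: o; apply: num_components_relabel => x;
  rewrite ?dual_flag_edge ?twist_flag_edge.
Qed.

Lemma isolated_twual (E : finType) (rho : seq twist_op) (G : ribbon_graph E) A :
  isolated (partial_twual rho G A) = isolated G.
Proof. by elim: rho G => //= o rho IH G; rewrite IH; case: o. Qed.

Definition conj_op (E : finType) (A : {set E}) (o : twist_op) (t : flag E -> flag E) :=
  match o with
  | delta => dual_flag A \o t \o dual_flag A
  | tau => twist_flag A \o t \o twist_flag A
  end.

Lemma conj_opK (E : finType) (A : {set E}) o t :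
  involutive t -> involutive (conj_op A o t).
Proof. by move=> tK; case: o => x /=; rewrite ?dual_flagK ?twist_flagK tK ?dual_flagK ?twist_flagK. Qed.

(** Instead of moving the arcs, one moves the matching, so that all twuals share the arcs of [G].
    The last operation is undone first, whence [foldr] against the [foldl] of [partial_twual]. *)
Lemma n_comp_matching_twual (E : finType) (rho : seq twist_op)
    (G : ribbon_graph E) A t : involutive t ->
  n_comp (matching_rel t (Defs.arc (partial_twual rho G A))) predT =
  n_comp (matching_rel (foldr (conj_op A) t rho) (Defs.arc G)) predT.
Proof.
move=> tK; elim: rho G => [G|o rho IH G]; first by [].
rewrite [partial_twual _ _ _]/= {}IH.
have tK' : involutive (foldr (conj_op A) t rho).
  by elim: rho => //= o' rho; apply: conj_opK.
case: o => /=.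
  exact: n_comp_matching_relabel (dual_flagK A) G _ tK'.
exact: n_comp_matching_relabel (twist_flagK A) G _ tK'.
Qed.

(* The effect on translations (i, s) |-> (i + p.1, s + p.2) of conjugation by
   (i, s) |-> (s, i), resp. by (i, s) |-> (i, s + i). *)
Definition op_flip (o : twist_op) (p : bool * bool) : bool * bool :=
  if o is delta then (p.2, p.1) else (p.1, p.1 (+) p.2).

Lemma foldr_op_flip_neq0 rho p :
  p != (false, false) -> foldr op_flip p rho != (false, false).
Proof.
move=> p0; elim: rho => //= o rho.
by case: o (foldr _ _ _) => [] [[] []].
Qed.

Lemma conj_op_mixed_flip (E : finType) (A : {set E}) o r p :
  conj_op A o (mixed_flip r p A) =1 mixed_flip r (op_flip o p) A.
Proof.
move=> [[e i] s]; have [eA|eA] := boolP (e \in A).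
  case: o; rewrite /= /mixed_flip /= eA /= ?eA //=.
  by case: i s p => [] [] [[] []]; rewrite /= eA.
by case: o; rewrite /= /mixed_flip /= !(negbTE eA) /= !(negbTE eA).
Qed.

Lemma foldr_conj_flip (E : finType) (A : {set E}) rho p :
  foldr (conj_op A) (flip p) rho =1 mixed_flip p (foldr op_flip p rho) A.
Proof.
elim: rho => [x|o rho IH x]; first by rewrite /= /mixed_flip if_same.
rewrite -[RHS]/(mixed_flip p (op_flip o (foldr op_flip p rho)) A x).
by rewrite -conj_op_mixed_flip; case: o; rewrite /= IH.
Qed.

(** Vertices are the circuits of the segment matching and boundary components those of the side
    matching; isolated vertices count in both, whence the term [2 * isolated G]. *)
Lemma euler_genus_twual (E : finType) (rho : seq twist_op) (G : ribbon_graph E) A :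
  euler_genus (partial_twual rho G A) =
    2 * (num_components G)%:Z + #|E|%:Z - 2 * (isolated G)%:Z -
    (num_circuits (Defs.arc G) (false, true) (foldr op_flip (false, true) rho) A +
     num_circuits (Defs.arc G) (true, false) (foldr op_flip (true, false) rho) A)%N%:Z.
Proof.
have circE p : n_comp (matching_rel (flip p) (Defs.arc (partial_twual rho G A))) predT =
    num_circuits (Defs.arc G) p (foldr op_flip p rho) A.
  rewrite n_comp_matching_twual; last exact: flipK.
  exact: eq_n_comp_matching (foldr_conj_flip A rho p).
have segE : @seg E =1 flip (false, true) by move=> [[e i] s]; rewrite /= addbT addbF.
have sideE : @side E =1 flip (true, false) by move=> [[e i] s]; rewrite /= addbT addbF.
have vE : num_vertices (partial_twual rho G A) =
    (num_circuits (Defs.arc G) (false, true) (foldr op_flip (false, true) rho) A + isolated G)%N.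
  by rewrite -circE -(eq_n_comp_matching _ segE) -(isolated_twual rho G A).
have fE : num_boundaries (partial_twual rho G A) =
    (num_circuits (Defs.arc G) (true, false) (foldr op_flip (true, false) rho) A + isolated G)%N.
  by rewrite -circE -(eq_n_comp_matching _ sideE) -(isolated_twual rho G A).
rewrite /euler_genus num_components_twual vE fE /num_edges.
move: (num_circuits _ _ _ _) (num_circuits _ _ _ _) (isolated G) => v f k.
by rewrite !PoszD; ring.
Qed.

Lemma euler_genus_twual0 (E : finType) (rho : seq twist_op) (G : ribbon_graph E) :
  euler_genus (partial_twual rho G set0) = euler_genus G.
Proof.
have circ0 r u : num_circuits (Defs.arc G) r u set0 =
    n_comp (matching_rel (flip r) (Defs.arc G)) predT.
  by apply: eq_n_comp_matching => x; rewrite /mixed_flip inE.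
(* Viewing [G] as its twual by the empty word makes the circuit formula apply to both sides. *)
rewrite -[RHS]/(euler_genus (partial_twual [::] G set0)).
by rewrite !euler_genus_twual !circ0.
Qed.

Theorem corollary5p1 (E : finType) (G : ribbon_graph E) (rho : seq twist_op)
    (hrho : [\/ rho = [:: delta; tau], rho = [:: tau; delta],
                rho = [:: tau] | rho = [:: delta; tau; delta]]) :
  exists (A : {set E}) (s : seq E),
    [/\ uniq s,
        [set e in s] = A,
        euler_genus (partial_twual rho G A) = max_euler_genus rho G
      & sorted <=%R
          (euler_genus G ::
           [seq euler_genus (partial_twual rho G [set e in take k s])
              | k <- iota 1 (size s)])].
Proof.
pose p := foldr op_flip (false, true) rho; pose q := foldr op_flip (true, false) rho.
have p0 : p != (false, false) by exact: foldr_op_flip_neq0.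
have q0 : q != (false, false) by exact: foldr_op_flip_neq0.
pose c1 := num_circuits (Defs.arc G) (false, true) p.
pose c2 := num_circuits (Defs.arc G) (true, false) q.
pose eps A := euler_genus (partial_twual rho G A).
have eps_le A B : (c1 A + c2 A <= c1 B + c2 B)%N -> eps B <= eps A.
  by move=> le; rewrite /eps !euler_genus_twual lerD2l lerN2 lez_nat.
pose B := [arg max_(B > set0) eps B]%O.
have maxB : max_euler_genus rho G = eps B.
  rewrite /B; case: arg_maxP => // A _ leA; apply: le_anti.
  by rewrite le_bigmax andbT; apply/bigmax_leP; split=> [|C _]; apply: leA.
have exch r u := @num_circuits_exchange E _ r u (@arcK _ G) (@arc_neq _ G).
have step r u := @num_circuits_setU1 E _ r u (@arcK _ G) (@arc_neq _ G).
have [s [us _ le_s sorted_s]] := greedy_chain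
  (exch (false, true) p isT p0) (exch (true, false) q isT q0)
  (step (false, true) p isT p0) (step (true, false) q isT q0) (sub0set B).
rewrite set0U in le_s.
exists [set e in s], s; split; [exact: us | by [] | |].
  (* The maximum bounds the value at the end of the chain, and the chain stops at a value at least
     that of the maximizer [B]. *)
  apply/le_anti/andP; split; first exact: le_bigmax.
  by rewrite maxB; apply: eps_le le_s.
have -> : euler_genus G = eps [set e in take 0 s].
  rewrite take0 /eps -(euler_genus_twual0 rho G).
  by congr (euler_genus (partial_twual _ _ _)); apply/setP=> z; rewrite !inE.
(* With [euler_genus G] as the value at the empty prefix, the whole sequence is indexed by prefix
   lengths from 0. *)
rewrite -[_ :: _]/[seq eps [set e in take k s] | k <- iota 0 (size s).+1].
apply/(sortedP 0) => k; rewrite size_map size_iota ltnS => lt.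
rewrite !(nth_map 0%N) ?size_iota ?ltnS ?(ltnW lt) // !nth_iota ?ltnS ?(ltnW lt) // !add0n.
by apply: eps_le; have := sorted_s k lt; rewrite !set0U.
Qed.
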